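(* Let $f:\mathbb{R}^D\to\mathbb{R}$ be a twice differentiable function whose Hessian $\bm{H}(\cdot)$ is Lipschitz continuous with constant $\gamma_H$, i.e. $\|\bm{H}(\bm{x}_1)-\bm{H}(\bm{x}_2)\|\le \gamma_H\|\bm{x}_1-\bm{x}_2\|$ for all $\bm{x}_1,\bm{x}_2\in\mathbb{R}^D$. Let $(\bm{x}^{(i)},z^{(i)})$ and $(\bm{x}^{(j)},z^{(j)})$ be two samples with $\bm{x}^{(i)}\neq\bm{x}^{(j)}$ in $\mathbb{R}^D$, $z^{(i)}=f(\bm{x}^{(i)})$ and $z^{(j)}=f(\bm{x}^{(j)})$. Then $$\Big|\tilde g_{ij}-\bm{g}^{(i)\top}\bm{u}_{ij}\Big|\le \frac{1}{6}\gamma_H\mu_{ij}^2+\frac{1}{2}H^{(i)}\mu_{ij}.$$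
   Context: $\|\cdot\|$ denotes the Euclidean 2-norm for vectors and the spectral norm for matrices. $\bm{g}^{(i)}\in\mathbb{R}^D$ is the gradient of $f$ at $\bm{x}^{(i)}$, $\bm{H}^{(i)}=\bm{H}(\bm{x}^{(i)})\in\mathbb{R}^{D\times D}$ is the Hessian of $f$ at $\bm{x}^{(i)}$, and the scalar $H^{(i)}=\|\bm{H}^{(i)}\|>0$ is its spectral norm. For two samples, $\bm{a}_{ij}=\bm{x}^{(j)}-\bm{x}^{(i)}$, $\mu_{ij}=\|\bm{a}_{ij}\|$, $\bm{u}_{ij}=\bm{a}_{ij}/\mu_{ij}$, and the directional slope estimate is $\tilde g_{ij}=\frac{z^{(j)}-z^{(i)}}{\mu_{ij}}$. *)

(* Defs.v *)
From mathcomp Require Import all_boot all_order all_algebra.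
From mathcomp Require Import all_classical all_reals all_analysis.
Import Order.TTheory GRing.Theory Num.Theory.
Import numFieldNormedType.Exports.

Set Implicit Arguments.
Unset Strict Implicit.
Unset Printing Implicit Defensive.

Local Open Scope classical_set_scope.
Local Open Scope ring_scope.

(* The library norm on matrices is the max norm, so the Euclidean norm and the
   spectral norm are defined here. Differentiability below refers to the
   library norm; as all norms on R^D are equivalent, it is the usual Frechet
   differentiability. *)

Definition norm2 (R : realType) (D : nat) (v : 'cV[R]_D) : R :=
  Num.sqrt (\sum_(i < D) v i 0 ^+ 2).

(* Operator norm induced by the Euclidean norm. *)
Definition spectral_norm (R : realType) (D : nat) (A : 'M[R]_D) : R :=
  sup [set norm2 (A *m v) | v in [set v : 'cV[R]_D | norm2 v <= 1]].

Definition gradient (R : realType) (D : nat) (f : 'cV[R]_D -> R)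
    (x : 'cV[R]_D) : 'cV[R]_D :=
  \col_(i < D) 'D_(delta_mx i 0) f x.

Definition hessian (R : realType) (D : nat) (f : 'cV[R]_D -> R)
    (x : 'cV[R]_D) : 'M[R]_D :=
  \matrix_(i < D, j < D)
    'D_(delta_mx i 0) (fun y : 'cV[R]_D => 'D_(delta_mx j 0) f y) x.

Definition twice_differentiable (R : realType) (D : nat)
    (f : 'cV[R]_D -> R) : Prop :=
  (forall x : 'cV[R]_D, differentiable f x) /\
  (forall x : 'cV[R]_D, differentiable (gradient f) x).

Definition displacement (R : realType) (D : nat) (xi xj : 'cV[R]_D) :
  'cV[R]_D := xj - xi.

Definition distance (R : realType) (D : nat) (xi xj : 'cV[R]_D) : R :=
  norm2 (displacement xi xj).

Definition direction (R : realType) (D : nat) (xi xj : 'cV[R]_D) :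
  'cV[R]_D := (distance xi xj)^-1 *: displacement xi xj.

Definition slope_estimate (R : realType) (D : nat) (xi xj : 'cV[R]_D)
    (zi zj : R) : R := (zj - zi) / distance xi xj.

(* Main.v *)
Require Import Defs.
From mathcomp Require Import all_boot all_order all_algebra.
From mathcomp Require Import all_classical all_reals all_analysis.
From mathcomp Require Import ring lra.
Import Order.TTheory GRing.Theory Num.Theory.
Import numFieldNormedType.Exports.

Set Implicit Arguments.
Unset Strict Implicit.
Unset Printing Implicit Defensive.

Local Open Scope ring_scope.

(** Restrict f to the segment from xi to xj: with d = xj - xi and mu its
    length, put p t = f (xi + t d). Then p' t is the dot product of d with the
    gradient at xi + t d, and p'' t is the Hessian quadratic form of d there
    ([is_derive_line], [is_derive_line_gradient]). After multiplication by mu,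
    the quantity to bound is the first-order Taylor remainder
    p 1 - p 0 - p' 0.

    Splitting the Hessian at xi + t d as the one at xi plus an increment of
    spectral norm at most gammaH * t * mu, and bounding quadratic forms by
    spectral norms ([quadratic_form_le]), gives
    |p'' t| <= H mu^2 + gammaH mu^3 t with H the spectral norm at xi. A second
    derivative bounded by a + b t yields a remainder of at most a / 2 + b / 6
    ([taylor2_norm_le]), and dividing by mu gives the stated bound.

    No integral of p'' is taken: the Taylor bound comes from comparing p' and
    then p with explicit polynomials through the mean value theorem
    ([ler_of_derive]). *)

Definition dot (R : realType) (D : nat) (u v : 'cV[R]_D) : R :=
  (u^T *m v) 0 0.

Lemma dotE (R : realType) (D : nat) (u v : 'cV[R]_D) :
  dot u v = \sum_i u i 0 * v i 0.
Proof. by rewrite /dot mxE; apply: eq_bigr => i _; rewrite mxE. Qed.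

Lemma dotBr (R : realType) (D : nat) (u v w : 'cV[R]_D) :
  dot u (v - w) = dot u v - dot u w.
Proof.
by rewrite !dotE -sumrB; apply: eq_bigr => i _; rewrite !mxE mulrBr.
Qed.

Lemma norm2_ge0 (R : realType) (D : nat) (v : 'cV[R]_D) : 0 <= norm2 v.
Proof. exact: sqrtr_ge0. Qed.

Lemma sqr_norm2 (R : realType) (D : nat) (v : 'cV[R]_D) :
  norm2 v ^+ 2 = \sum_i v i 0 ^+ 2.
Proof. by rewrite sqr_sqrtr// sumr_ge0// => i _; exact: sqr_ge0. Qed.

Lemma norm2Z (R : realType) (D : nat) (k : R) (v : 'cV[R]_D) :
  norm2 (k *: v) = `|k| * norm2 v.
Proof.
rewrite -sqrtr_sqr -sqrtrM ?sqr_ge0// /norm2 mulr_sumr; congr Num.sqrt.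
by apply: eq_bigr => i _; rewrite mxE exprMn.
Qed.

Lemma norm2_gt0 (R : realType) (D : nat) (v : 'cV[R]_D) :
  v != 0 -> 0 < norm2 v.
Proof.
move=> v0; rewrite lt_def norm2_ge0 andbT; apply: contra v0.
rewrite -sqrf_eq0 sqr_norm2 psumr_eq0 => [/allP v0|i _]; last exact: sqr_ge0.
apply/eqP/colP => i; rewrite mxE; apply/eqP.
by rewrite -sqrf_eq0; apply: v0; rewrite mem_index_enum.
Qed.

(** Lagrange's identity: the sum of the squared 2x2 minors of the pair (u, v),
    counted over ordered pairs of indices, is twice the Cauchy-Schwarz
    defect. *)
Lemma cauchy_schwarz (R : realType) (D : nat) (u v : 'cV[R]_D) :
  `|dot u v| <= norm2 u * norm2 v.
Proof.
rewrite -ler_sqr ?nnegrE ?mulr_ge0 ?norm2_ge0// real_normK ?num_real//.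
rewrite exprMn !sqr_norm2 dotE -subr_ge0.
have : 0 <= \sum_i \sum_j (u i 0 * v j 0 - u j 0 * v i 0) ^+ 2.
  by apply: sumr_ge0 => i _; apply: sumr_ge0 => j _; exact: sqr_ge0.
have -> : \sum_i \sum_j (u i 0 * v j 0 - u j 0 * v i 0) ^+ 2 =
    2 * ((\sum_i u i 0 ^+ 2) * (\sum_i v i 0 ^+ 2)
         - (\sum_i u i 0 * v i 0) ^+ 2).
  rewrite mulrBr mulr_natl mulr2n [X in _ + X - _]mulrC expr2 !big_distrlr/=.
  rewrite mulr_sumr -sumrN -!big_split/=; apply: eq_bigr => i _.
  rewrite mulr_sumr -sumrN -!big_split/=; apply: eq_bigr => j _.
  by ring.
by rewrite pmulr_rge0.
Qed.

(** The supremum of an unbounded set has a default value, so this is what makes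
    the spectral norm an actual bound; the Frobenius norm serves as a witness,
    by Cauchy-Schwarz on each row. *)
Lemma spectral_norm_has_ubound (R : realType) (D : nat) (A : 'M[R]_D) :
  has_ubound [set norm2 (A *m v) | v in [set v : 'cV[R]_D | norm2 v <= 1]]%classic.
Proof.
exists (Num.sqrt (\sum_i norm2 (row i A)^T ^+ 2)) => _ [v /= v1 <-].
apply: ler_wsqrtr; apply: ler_sum => i _.
rewrite -ler_sqrt ?sqr_ge0// !sqrtr_sqr [leRHS]ger0_norm ?norm2_ge0//.
have -> : (A *m v) i 0 = dot (row i A)^T v.
  by rewrite mxE dotE; apply: eq_bigr => j _; rewrite !mxE.
by rewrite (le_trans (cauchy_schwarz _ _))// ler_piMr ?norm2_ge0.
Qed.

Lemma norm2_mulmx_le (R : realType) (D : nat) (A : 'M[R]_D) (v : 'cV[R]_D) :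
  norm2 (A *m v) <= spectral_norm A * norm2 v.
Proof.
have [->|v0] := eqVneq v 0.
  rewrite mulmx0; have -> : norm2 (0 : 'cV[R]_D) = 0; last by rewrite mulr0.
  by rewrite -(scale0r (0 : 'cV[R]_D)) norm2Z normr0 mul0r.
have nv0 := norm2_gt0 v0.
rewrite -ler_pdivrMr// mulrC -[(norm2 v)^-1]ger0_norm ?invr_ge0 ?norm2_ge0//.
rewrite -norm2Z scalemxAr; apply: ub_le_sup.
  exact: spectral_norm_has_ubound.
exists ((norm2 v)^-1 *: v) => //=.
by rewrite norm2Z ger0_norm ?invr_ge0 ?norm2_ge0// mulVf ?gt_eqF.
Qed.

Lemma quadratic_form_le (R : realType) (D : nat) (A : 'M[R]_D) (v : 'cV[R]_D) :
  `|dot v (A *m v)| <= spectral_norm A * norm2 v ^+ 2.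
Proof.
rewrite (le_trans (cauchy_schwarz _ _))// expr2 mulrA [leRHS]mulrC.
by rewrite ler_wpM2l ?norm2_ge0// norm2_mulmx_le.
Qed.

(** The mean value theorem applied to v - u, whose derivative is nonnegative.
    It lets a bound on a derivative be integrated when the derivative is only
    known to exist pointwise. *)
Lemma ler_of_derive (R : realType) (u v u' v' : R -> R) :
  (forall t : R, is_derive t 1 u (u' t)) ->
  (forall t : R, is_derive t 1 v (v' t)) ->
  (forall t, 0 <= t -> u' t <= v' t) -> u 0 = v 0 ->
  forall t, 0 <= t -> u t <= v t.
Proof.
move=> du dv le' eq0 t t0.
have dw (s : R) : is_derive s 1 (v - u) (v' s - u' s) by exact: is_deriveB.
have cw : {within `[0, t], continuous (v - u)}%classic.
  apply: continuous_subspaceT => x.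
  by apply: differentiable_continuous; apply/derivable1_diffP; case: (dw x).
have [c] := MVT_segment t0 (fun x _ => dw x) cw.
rewrite in_itv/= => /andP[c0 _] /eqP.
rewrite !fctE eq0 subrr !subr0 => /eqP eqt.
by rewrite -subr_ge0 eqt mulr_ge0// subr_ge0 le'.
Qed.

Lemma is_derive_monomial (R : realType) (c : R) (n : nat) (t : R) :
  is_derive t 1 (fun s => c * s ^+ n) (c * (n%:R * t ^+ n.-1)).
Proof.
have := is_deriveZ c (is_deriveX n (is_derive_id t (1 : R))).
by rewrite exprfctE/= /GRing.scale/= mulr1.
Qed.

(** The first power is kept so that every nonconstant term is an instance of
    [is_derive_monomial]; the derivative of the cubic below is then
    syntactically of this form. *)
Lemma is_derive_quadratic (R : realType) (k a b t : R) :
  is_derive t 1 (fun s => k + a * s ^+ 1 + b / 2 * s ^+ 2) (a + b * t).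
Proof.
apply: (is_derive_eq (is_deriveD (is_deriveD (is_derive_cst k t 1)
  (is_derive_monomial a 1 t)) (is_derive_monomial (b / 2) 2 t))).
by rewrite expr0 expr1; field.
Qed.

Lemma is_derive_cubic (R : realType) (k l a b t : R) :
  is_derive t 1 (fun s => k + l * s ^+ 1 + a / 2 * s ^+ 2 + b / 6 * s ^+ 3)
    (l + a * t ^+ 1 + b / 2 * t ^+ 2).
Proof.
apply: (is_derive_eq (is_deriveD (is_deriveD (is_deriveD (is_derive_cst k t 1)
  (is_derive_monomial l 1 t)) (is_derive_monomial (a / 2) 2 t))
  (is_derive_monomial (b / 6) 3 t))).
by rewrite /= expr0 !expr1; field.
Qed.

(** The bound on p'' is integrated twice by [ler_of_derive]: first p' is
    compared with a quadratic polynomial, then p with a cubic one. *)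
Lemma taylor2_le (R : realType) (p p' p'' : R -> R) (a b : R) :
  (forall t : R, is_derive t 1 p (p' t)) ->
  (forall t : R, is_derive t 1 p' (p'' t)) ->
  (forall t, 0 <= t -> p'' t <= a + b * t) ->
  p 1 - p 0 - p' 0 <= a / 2 + b / 6.
Proof.
move=> dp dp' le2.
have le1 t : 0 <= t -> p' t <= p' 0 + a * t ^+ 1 + b / 2 * t ^+ 2.
  apply: (ler_of_derive dp' (fun s => is_derive_quadratic (p' 0) a b s) le2).
  by rewrite !expr0n/= !mulr0 !addr0.
have := ler_of_derive dp (fun s => is_derive_cubic (p 0) (p' 0) a b s) le1.
rewrite !expr0n/= !mulr0 !addr0 => /(_ erefl 1 ler01).
rewrite !expr1n; lra.
Qed.

Lemma taylor2_norm_le (R : realType) (p p' p'' : R -> R) (a b : R) :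
  (forall t : R, is_derive t 1 p (p' t)) ->
  (forall t : R, is_derive t 1 p' (p'' t)) ->
  (forall t, 0 <= t -> `|p'' t| <= a + b * t) ->
  `|p 1 - p 0 - p' 0| <= a / 2 + b / 6.
Proof.
move=> dp dp' le2; rewrite ler_norml; apply/andP; split; last first.
  apply: (taylor2_le dp dp') => t t0; exact: le_trans (ler_norm _) (le2 t t0).
(* The lower bound is the upper bound for the opposite function. *)
have le2N t : 0 <= t -> (- p'') t <= a + b * t.
  by move=> t0; rewrite (le_trans _ (le2 t t0))// -normrN ler_norm.
have := taylor2_le (fun t => is_deriveN (dp t)) (fun t => is_deriveN (dp' t))
  le2N.
rewrite !fctE; lra.
Qed.

(** Chain rule along a line, with the directional derivative expanded on the
    canonical basis. *)
Lemma is_derive_line (R : realType) (D : nat) (h : 'cV[R]_D -> R)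
    (x d : 'cV[R]_D) (t : R) :
  (forall y, differentiable h y) ->
  is_derive t 1 (fun s => h (x + s *: d)) (dot d (gradient h (x + t *: d))).
Proof.
move=> dh; set y := x + t *: d.
have dhy : 'D_d h y = dot d (gradient h y).
  rewrite deriveE// [in LHS](matrix_sum_delta d) dotE linear_sum/=.
  by apply: eq_bigr => i _; rewrite big_ord1 linearZ/= mxE deriveE.
(* The difference quotients of the restriction to the line are those that
   define the derivative of h at y in the direction d. *)
have quotientE : (fun e : R => e^-1 *:
      (((fun s => h (x + s *: d)) \o shift t) (e *: 1) - h (x + t *: d))) =
    (fun e : R => e^-1 *: ((h \o shift y) (e *: d) - h y)).
  apply/funext => e /=; congr (_ *: (h _ - _)).
  by rewrite /y [e *: 1]mulr1 scalerDl addrCA.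
have dhd : derivable h y d by exact: diff_derivable.
by apply: DeriveDef; rewrite /derivable /derive quotientE.
Qed.

(** Each partial derivative of f is differentiable, so [is_derive_line] applies
    to it; regrouping the resulting double sum gives the Hessian form. *)
Lemma is_derive_line_gradient (R : realType) (D : nat) (f : 'cV[R]_D -> R)
    (x d : 'cV[R]_D) (t : R) :
  (forall y, differentiable (gradient f) y) ->
  is_derive t 1 (fun s => dot d (gradient f (x + s *: d)))
    (dot d (hessian f (x + t *: d) *m d)).
Proof.
move=> df.
have dcoord i y : differentiable (fun z => gradient f z i 0) y.
  exact: (differentiable_comp (df y) (differentiable_coord _ _ _)).
have partialE i : (fun z => gradient f z i 0) =
    (fun z => 'D_(delta_mx i 0) f z).
  by apply/funext => z; rewrite mxE.
have -> : (fun s => dot d (gradient f (x + s *: d))) =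
    \sum_i d i 0 *: (fun s => gradient f (x + s *: d) i 0).
  by apply/funext => s; rewrite dotE fct_sumE.
apply: (is_derive_eq (is_derive_sum (fun i =>
  is_deriveZ (d i 0) (is_derive_line x d t (dcoord i))))).
transitivity (\sum_i \sum_j d i 0 * (d j 0 * hessian f (x + t *: d) j i)).
  apply: eq_bigr => i _; rewrite /GRing.scale/= dotE mulr_sumr.
  apply: eq_bigr => j _; rewrite !mxE; congr (_ * (_ * _)).
  by rewrite partialE.
rewrite exchange_big/= dotE; apply: eq_bigr => j _.
rewrite mxE mulr_sumr; apply: eq_bigr => i _; ring.
Qed.

Theorem lemma3p1 (R : realType) (D : nat) (f : 'cV[R]_D -> R) (gammaH : R)
    (f_diff2 : twice_differentiable f)
    (H_lip : forall x1 x2 : 'cV[R]_D,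
      spectral_norm (hessian f x1 - hessian f x2) <= gammaH * norm2 (x1 - x2))
    (xi xj : 'cV[R]_D) (zi zj : R)
    (xi_neq_xj : xi <> xj) (zi_def : zi = f xi) (zj_def : zj = f xj) :
  `| slope_estimate xi xj zi zj
     - ((gradient f xi)^T *m direction xi xj) 0 0 |
  <= 6%:R^-1 * gammaH * distance xi xj ^+ 2
     + 2%:R^-1 * spectral_norm (hessian f xi) * distance xi xj.
Proof.
have [df dg] := f_diff2.
rewrite /slope_estimate /direction zi_def zj_def.
set mu := distance xi xj; set d := displacement xi xj.
have mu_gt0 : 0 < mu.
  by apply: norm2_gt0; rewrite subr_eq0; apply/eqP => /esym.
have -> : ((gradient f xi)^T *m (mu^-1 *: d)) 0 0 = dot d (gradient f xi) / mu.
  rewrite -scalemxAr [LHS]mxE mulrC dotE mxE; congr (_ * _).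
  by apply: eq_bigr => i _; rewrite mxE mulrC.
have hess_bound t : 0 <= t -> `|dot d (hessian f (xi + t *: d) *m d)| <=
    spectral_norm (hessian f xi) * mu ^+ 2 + gammaH * mu ^+ 3 * t.
  move=> t0; set H := hessian f (xi + t *: d); set H0 := hessian f xi.
  have -> : dot d (H *m d) = dot d (H0 *m d) + dot d ((H - H0) *m d).
    by rewrite mulmxBl dotBr [RHS]addrC subrK.
  rewrite (le_trans (ler_normD _ _))// lerD ?quadratic_form_le//.
  rewrite (le_trans (quadratic_form_le _ _))//.
  (* One factor mu comes from the Lipschitz bound, the other two from the
     quadratic form. *)
  have := H_lip (xi + t *: d) xi.
  rewrite [xi + _ - xi]addrC addKr norm2Z (ger0_norm t0) => lip.
  rewrite (le_trans (ler_wpM2r (sqr_ge0 _) lip))//.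
  suff -> : gammaH * (t * norm2 d) * norm2 d ^+ 2 = gammaH * mu ^+ 3 * t by [].
  by rewrite -[norm2 d]/mu; ring.
have := taylor2_norm_le (fun t => is_derive_line xi d t df)
  (fun t => is_derive_line_gradient xi d t dg) hess_bound.
rewrite scale1r scale0r addr0 [xi + d]addrC subrK => taylor.
rewrite -mulrBl normrM normfV (gtr0_norm mu_gt0) ler_pdivrMr//.
by rewrite (le_trans taylor)// le_eqVlt; apply/orP; left; apply/eqP; field.
Qed.
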